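(* Let $G$ be a finite group of rotations of $\mathbb{R}^3$ and consider its $p$th irreducible representation (irrep), of dimension $d_p$. Real-valued orthonormal basis functions of the $p$th irrep of $G$ exist if and only if the real-valued $p$th irrep exists for $G$. That is, the following are equivalent: (a) there exist a unitary matrix realization $g\mapsto\Gamma^p(g)\in\mathbb{C}^{d_p\times d_p}$ of the $p$th irrep and real-valued functions $F_{p,1},\dots,F_{p,d_p}$ on the unit sphere, orthonormal in $L^2(S^2)$, which form a basis associated with the $p$th irrep (with matrices $\Gamma^p(g)$); (b) there exists a unitary matrix realization of the $p$th irrep all of whose matrices $\Gamma^p(g)$, $g\in G$, have real entries.
   Context: $G$ is a finite group of rotations; $R_g\in\mathbb{R}^{3\times3}$, with $R_g^{-1}=R_g^T$ and $\det R_g=1$, denotes the rotation matrix corresponding to $g\in G$ (so $G$ is identified with a finite subgroup of $SO(3)$). The abstract rotation operator is $P(g)f(\mathbf{x})=f(R_g^{-1}\mathbf{x})$, acting componentwise on vector-valued functions. The irreps of $G$ are considered up to equivalence and indexed by $p$; a unitary matrix realization of the $p$th irrep is a homomorphism $g\mapsto\Gamma^p(g)$ into unitary $d_p\times d_p$ complex matrices belonging to the $p$th equivalence class. Linearly independent functions $F_{p,1},\dots,F_{p,d_p}$ on the unit sphere $S^2$ (functions of $\mathbf{x}/\|\mathbf{x}\|_2$) form a basis of $G$ associated with the $p$th irrep (with matrices $\Gamma^p(g)$) if for every $g\in G$ and $j\in\{1,\dots,d_p\}$, $P(g)F_{p,j}=\sum_{m=1}^{d_p}(\Gamma^p(g))_{m,j}F_{p,m}$;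 equivalently, with $F_p=(F_{p,1},\dots,F_{p,d_p})^T$, $P(g)F_p=(\Gamma^p(g))^TF_p$. Orthonormality is with respect to integration over the surface of the unit sphere with $d\Omega=\sin\theta\,d\theta\,d\phi$. *)

(* Defs.v *)
From HB Require Import structures.
From mathcomp Require Import all_boot all_order all_algebra all_fingroup.
From mathcomp Require Import all_character complex.
From mathcomp Require Import all_classical all_reals all_analysis.

Set Implicit Arguments.
Unset Strict Implicit.
Unset Printing Implicit Defensive.

Import Order.TTheory GRing.Theory Num.Theory.
Local Open Scope classical_set_scope.
Local Open Scope ring_scope.
Local Open Scope complex_scope.

Definition is_rotation (R : realType) (A : 'M[R]_3) : Prop :=
  A *m A^T = 1%:M /\ \det A = 1.

(* The faithfulness of [rot] identifies [G] with a finite subgroup of SO(3). *)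
Definition rotation_group (R : realType) (gT : finGroupType) (G : {group gT})
    (rot : mx_representation R G 3) : Prop :=
  mx_faithful rot /\ forall g, g \in G -> is_rotation (rot g).

Definition rotation_op (R : realType) (T : Type) (A : 'M[R]_3)
    (f : 'cV[R]_3 -> T) : 'cV[R]_3 -> T :=
  fun x => f (invmx A *m x).

(* Functions on the unit sphere are represented by functions on R^3; every
   notion below depends only on their values on [unit_sphere]. *)
Definition unit_sphere (R : realType) : set 'cV[R]_3 :=
  [set x : 'cV[R]_3 | \sum_i x i 0 ^+ 2 = 1].
Arguments unit_sphere : clear implicits.

Definition spherical_point (R : realType) (theta phi : R) : 'cV[R]_3 :=
  \col_(i < 3)
    [:: sin theta * cos phi; sin theta * sin phi; cos theta]`_i.

Definition angles (R : realType) : set (R * R) :=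
  `[0, pi] `*` `[0, 2 * pi].
Arguments angles : clear implicits.

(* Integral with respect to dOmega = sin theta dtheta dphi. *)
Definition sphere_integral (R : realType) (f : 'cV[R]_3 -> R) : \bar R :=
  (\int[lebesgue_measure \x lebesgue_measure]_(a in angles R)
     (f (spherical_point a.1 a.2) * sin a.1)%:E)%E.

(* A function on the sphere is Borel measurable iff it is so in spherical
   coordinates. *)
Definition sphere_L2 (R : realType) (f : 'cV[R]_3 -> R) : Prop :=
  measurable_fun (angles R) (fun a => f (spherical_point a.1 a.2)) /\
  (sphere_integral (fun x => (f x ^+ 2)%R) < +oo)%E.

Definition sphere_orthonormal (R : realType) (d : nat)
    (F : 'I_d -> 'cV[R]_3 -> R) : Prop :=
  (forall j, sphere_L2 (F j)) /\
  (forall j k, sphere_integral (fun x => F j x * F k x) = (j == k)%:R%:E).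

Definition sphere_lin_indep (R : realType) (d : nat)
    (F : 'I_d -> 'cV[R]_3 -> R[i]) : Prop :=
  forall c : 'I_d -> R[i],
    (forall x, unit_sphere R x -> \sum_(j < d) c j * F j x = 0) ->
    forall j, c j = 0.

Definition is_basis_of_irrep (R : realType) (gT : finGroupType)
    (G : {group gT}) (rot : mx_representation R G 3) (d : nat)
    (Gamma : mx_representation R[i] G d)
    (F : 'I_d -> 'cV[R]_3 -> R[i]) : Prop :=
  sphere_lin_indep F /\
  forall g, g \in G -> forall (j : 'I_d) (x : 'cV[R]_3), unit_sphere R x ->
    rotation_op (rot g) (F j) x = \sum_(m < d) Gamma g m j * F m x.

(* An equivalence class of irreps is given by a representative [rho]. *)
Definition unitary_realization (R : realType) (gT : finGroupType)
    (G : {group gT}) (d : nat) (rho Gamma : mx_representation R[i] G d) : Prop :=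
  mx_rsim Gamma rho /\ forall g, g \in G -> Gamma g \is unitarymx.

(* Main.v *)
Require Import Defs.
From HB Require Import structures.
From mathcomp Require Import all_boot all_order all_algebra all_fingroup.
From mathcomp Require Import all_character complex.
From mathcomp Require Import all_classical all_reals all_analysis.
From mathcomp Require Import measurable_realfun ring lra.

(** Real basis functions force real matrices: taking imaginary parts in
    P(g) F_j = sum_m Gamma(g)_(m,j) F_m, whose left side is real, gives
    sum_m Im(Gamma(g)_(m,j)) F_m = 0, and linear independence of the F_m makes
    every Im(Gamma(g)_(m,j)) vanish ([realmx_of_real_basis]).

    Conversely let A(g) be real orthogonal matrices with A(gh) = A(g)A(h).  Any
    function H from the sphere to R^d gives an equivariant one,
    F(x) = sum_g A(g) H(g^-1 x), and this sum is easy to control when H is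
    supported on a set D whose translates gD are disjoint.  Such a D is the
    Dirichlet cell of a point u that no g <> 1 fixes, that is, the set of the
    y for which u.y is larger than every other u.(gy).  Cut D into finitely many
    strips E_i of positive area, and let H have the coordinates
    H_l = sum_i h_l(i) 1_(E_i).  The Gram matrix of F is then
      sum_g A(g) (sum_i h(i) h(i)^T w_g(i)) A(g)^T,   w_g(i) = area(g E_i),
    so F is orthogonal with equal norms as soon as the vectors h_1, .., h_d are
    orthogonal and have equal norms for each of the finitely many weights w_g at
    once: the inner matrix is then a scalar c_g, and A(g) c_g A(g)^T = c_g.

    To obtain such vectors, write h_l(i) = sqrt(a_l(i)) with a_l >= 0 of disjoint
    supports.  The requirement becomes that d disjoint groups of the vectors
    (w_g(i))_g have a common nonnegative combination, which is a form of
    Tverberg's theorem ([tverberg_cone]).  With sufficiently many strips it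
    follows by iterating Radon's argument: a linear dependency between k+1
    vectors of R^k, split by signs, is a vector with two disjoint
    representations, and repeating this on 2^t-fold represented vectors doubles
    the number of representations.

    Linear independence holds because the h_l have disjoint supports: on a strip
    E_i with h_k(i) <> 0 the function F_k is the only nonzero one. *)

Set Implicit Arguments.
Unset Strict Implicit.
Unset Printing Implicit Defensive.

Import Order.TTheory GRing.Theory Num.Theory.
Import numFieldNormedType.Exports.

Local Open Scope ring_scope.
Local Open Scope complex_scope.

(** * Disjoint cones with a common point *)

(** The positive and the negative part of a linear dependency among more vectors
    than the dimension.  The assumption puts the vectors in an open half-space,
    which keeps the common combination away from 0. *)
Lemma radon_cone (R : realFieldType) (K : finType) (w : 'I_#|K|.+1 -> K -> R) :
  (forall i, 0 < \sum_k w i k) ->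
  exists a : bool -> 'I_#|K|.+1 -> R,
    [/\ forall b i, 0 <= a b i,
        forall i, a true i * a false i = 0,
        forall k, \sum_i a true i * w i k = \sum_i a false i * w i k
      & 0 < \sum_k \sum_i a true i * w i k].
Proof.
move=> w_gt0.
pose M := \matrix_(i < #|K|.+1, j < #|K|) w i (enum_val j).
have /rowV0Pn[u /sub_kermxP uM u_neq0] : kermx M != 0.
  rewrite -mxrank_eq0 mxrank_ker -lt0n subn_gt0.
  exact: leq_ltn_trans (rank_leq_col M) _.
pose a (b : bool) i := if b then Num.max 0 (u 0 i) else Num.max 0 (- u 0 i).
have a_ge0 b i : 0 <= a b i by case: b; rewrite /a le_max lexx.
have aB i : u 0 i = a true i - a false i.
  by rewrite /a; case: ltgtP => ?; case: ltgtP => ?; lra.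
have aw k : \sum_i a true i * w i k = \sum_i a false i * w i k.
  apply/eqP; rewrite -subr_eq0 -sumrB; apply/eqP.
  have /matrixP/(_ 0 (enum_rank k)) := uM; rewrite !mxE; apply: etrans.
  by apply: eq_bigr => i _; rewrite !mxE enum_rankK -mulrBl -aB.
exists a; split=> //.
  by move=> i; rewrite /a; case: ltgtP => ?; case: ltgtP => ?; nra.
have swap b : \sum_k \sum_i a b i * w i k = \sum_i a b i * \sum_k w i k.
  by rewrite exchange_big; apply: eq_bigr => i _; rewrite mulr_sumr.
have term_ge0 b i : 0 <= a b i * \sum_k w i k by rewrite mulr_ge0 // ltW.
rewrite lt_neqAle {2}(swap true) sumr_ge0 // andbT eq_sym.
apply: contra u_neq0 => sum0.
have a0 b i : a b i = 0.
  have : \sum_k \sum_i a b i * w i k == 0.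
    by case: b => //; under eq_bigr do rewrite -aw.
  rewrite swap psumr_eq0 // => /allP/(_ i); rewrite mem_index_enum => /(_ isT).
  by rewrite mulf_eq0 (gt_eqF (w_gt0 i)) orbF => /eqP.
by apply/eqP/rowP => i; rewrite mxE aB !a0 subrr.
Qed.

(** The set I of indices consists of #|K|+1 blocks of the previous index set.  By
    induction each block i yields a vector c_i with 2^t disjoint representations,
    and Radon's argument represents one vector in two ways by disjoint sets of
    the c_i; unfolding gives 2^(t+1) disjoint representations. *)
Lemma tverberg_cone (R : realFieldType) (K : finType) (t : nat) :
  exists I : finType, forall w : I -> K -> R,
    (forall i, 0 < \sum_k w i k) ->
    exists (a : nat -> I -> R) (c : K -> R),
      [/\ forall l i, 0 <= a l i,
          forall l m i, (l < 2 ^ t)%N -> (m < 2 ^ t)%N -> l != m ->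
            a l i * a m i = 0,
          forall l k, (l < 2 ^ t)%N -> \sum_i a l i * w i k = c k
        & 0 < \sum_k c k].
Proof.
elim: t => [|t [I IH]].
  exists unit => w w_gt0; exists (fun _ _ => 1), (w tt); split=> //.
    by case=> // -[].
  by move=> l k _; rewrite (bigD1 tt) //= mul1r big1 ?addr0 // => -[].
exists ('I_#|K|.+1 * I)%type => w w_gt0.
have /choice[a /choice[c ac]] : forall i, exists (a : nat -> I -> R) (c : K -> R),
      [/\ forall l y, 0 <= a l y,
          forall l m y, (l < 2 ^ t)%N -> (m < 2 ^ t)%N -> l != m ->
            a l y * a m y = 0,
          forall l k, (l < 2 ^ t)%N -> \sum_y a l y * w (i, y) k = c k
        & 0 < \sum_k c k] by move=> i; exact: IH.
have [i|b [b_ge0 b_disj b_eq b_gt0]] := radon_cone (w := c).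
  by case: (ac i).
(* The lowest bit of the label l chooses the side of the Radon partition, and the
   other bits choose the representation within each block. *)
exists (fun l p => b (odd l) p.1 * a p.1 l./2 p.2).
exists (fun k => \sum_i b true i * c i k).
have half_lt l : (l < 2 ^ t.+1)%N -> (l./2 < 2 ^ t)%N.
  by rewrite expnS mul2n ltn_half_double.
split=> //.
- by move=> l [i y] /=; case: (ac i) => a_ge0 *; rewrite mulr_ge0.
- move=> l m [i y] /half_lt l_lt /half_lt m_lt lm /=.
  case: (ac i) => _ a_disj _ _; have [odd_eq|odd_neq] := eqVneq (odd l) (odd m).
    have half_neq : l./2 != m./2.
      apply: contra lm => /eqP half_eq.
      by rewrite -(odd_double_half l) -(odd_double_half m) odd_eq half_eq.
    by rewrite mulrACA a_disj // mulr0.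
  suff -> : b (odd l) i * a i l./2 y * (b (odd m) i * a i m./2 y) =
    b true i * b false i * (a i l./2 y * a i m./2 y) by rewrite b_disj mul0r.
  by case: (odd l) (odd m) odd_neq => -[] //= _; ring.
- move=> l k /half_lt l_lt.
  transitivity (\sum_i b (odd l) i * c i k); last by case: (odd l).
  transitivity (\sum_i \sum_y b (odd l) i * a i l./2 y * w (i, y) k).
    by rewrite pair_bigA; apply: eq_bigr => -[].
  apply: eq_bigr => i _; case: (ac i) => _ _ /(_ _ k l_lt) <- _.
  by rewrite mulr_sumr; apply: eq_bigr => y _; rewrite mulrA.
Qed.

(** * Area of subsets of the sphere *)

Section SphereArea.
Variable R : realType.
Implicit Types E : 'cV[R]_3 -> bool.
Local Open Scope classical_set_scope.

Local Notation mu := (@lebesgue_measure R \x @lebesgue_measure R)%E.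

Definition sphere_measurable E :=
  measurable_fun setT (fun a : R * R => E (spherical_point a.1 a.2)).

Definition area E : R := fine (sphere_integral (fun x => (E x)%:R)).

Lemma measurable_angles : measurable (angles R).
Proof. by apply: measurableX; exact: measurable_itv. Qed.

Lemma rectangle_measure (a b c d : R) : a < b -> c < d ->
  mu (`[a, b] `*` `[c, d]) = ((b - a) * (d - c))%:E.
Proof.
move=> ab cd; apply: etrans; first by apply: product_measure1E.
rewrite EFinM !EFinB; congr (_ * _)%E.
  by apply: etrans; [exact: lebesgue_measure_itv | rewrite /= lte_fin ab].
by apply: etrans; [exact: lebesgue_measure_itv | rewrite /= lte_fin cd].
Qed.

Lemma angles_finite : (mu (angles R) < +oo)%E.
Proof.
by rewrite rectangle_measure ?ltry // ?mulr_gt0 // pi_gt0.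
Qed.

Lemma measurable_sin_theta (D : set (R * R)) :
  measurable_fun D (fun a : R * R => sin a.1).
Proof.
apply: measurable_funTS; apply: measurableT_comp; last exact: measurable_fst.
by apply: continuous_measurable_fun; exact: continuous_sin.
Qed.

Lemma measurable_indicator (D : set (R * R)) E : sphere_measurable E ->
  measurable_fun D (fun a : R * R => (E (spherical_point a.1 a.2))%:R : R).
Proof.
move=> mE; apply: measurable_funTS.
rewrite (_ : (fun _ => _) = fun a : R * R =>
    if E (spherical_point a.1 a.2) then 1 else 0 : R); last first.
  by apply/funext => a; case: (E _).
by apply: measurable_fun_ifT.
Qed.

Lemma integrable_indicator E : sphere_measurable E ->
  mu.-integrable (angles R)
    (fun a => ((E (spherical_point a.1 a.2))%:R * sin a.1)%:E).
Proof.
move=> mE; apply: measurable_bounded_integrable.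
- exact: measurable_angles.
- exact: angles_finite.
- by apply: measurable_funM; [exact: measurable_indicator|
    exact: measurable_sin_theta].
- exists 1; split; first exact: num_real.
  move=> M M_gt1 a _ /=; rewrite normrM (le_trans _ (ltW M_gt1)) //.
  rewrite -[leRHS]mulr1; apply: ler_pM => //; last first.
    by rewrite ler_norml sin_geN1 sin_le1.
  by case: (E _); rewrite ?normr1 ?normr0.
Qed.

Lemma areaE E : sphere_measurable E ->
  sphere_integral (fun x => (E x)%:R) = (area E)%:E.
Proof.
move=> mE; rewrite fineK //; apply: integrable_fin_num.
  exact: measurable_angles.
exact: integrable_indicator.
Qed.

Lemma sin_angles_ge0 (a : R * R) : angles R a -> 0 <= sin a.1.
Proof. by move=> -[/= + _]; rewrite in_itv /= => /sin_ge0_pi. Qed.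

Lemma area_ge0 E : 0 <= area E.
Proof.
apply: fine_ge0; apply: integral_ge0 => a /sin_angles_ge0 sin_ge0.
by rewrite lee_fin mulr_ge0.
Qed.

Lemma area_false : area (fun=> false) = 0.
Proof.
by rewrite /area /sphere_integral integral0_eq // => a _; rewrite mul0r.
Qed.

Lemma sphere_integral_simple (P : finType) (E : P -> 'cV[R]_3 -> bool)
    (c : P -> R) :
  (forall p, sphere_measurable (E p)) ->
  sphere_integral (fun x => \sum_p c p * (E p x)%:R)
    = (\sum_p c p * area (E p))%:E.
Proof.
move=> mE.
have int p := integrable_indicator (mE p).
transitivity (\int[mu]_(a in angles R) \sum_p (c p)%:E *
    ((E p (spherical_point a.1 a.2))%:R * sin a.1)%:E)%E.
  apply: eq_integral => a _; rewrite mulr_suml -sumEFin.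
  by apply: eq_bigr => p _; rewrite -EFinM mulrA.
rewrite integral_sum; last 2 first.
- exact: measurable_angles.
- by move=> p; apply: integrableZl => //; exact: measurable_angles.
rewrite -sumEFin; apply: eq_bigr => p _.
rewrite integralZl //; last exact: measurable_angles.
by rewrite EFinM -areaE.
Qed.

Lemma area_gt0 E (a b c d m : R) : sphere_measurable E ->
  a < b -> c < d -> 0 < m ->
  (forall theta phi, a <= theta <= b -> c <= phi <= d ->
     [/\ 0 <= theta <= pi, 0 <= phi <= 2 * pi, m <= sin theta
       & E (spherical_point theta phi)]) ->
  0 < area E.
Proof.
move=> mE ab cd m_gt0 rectP.
rewrite -lte_fin -areaE //.
pose Q : set (R * R) := `[a, b] `*` `[c, d].
have mQ : measurable Q by apply: measurableX; exact: measurable_itv.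
have QP p : Q p -> [/\ angles R p, m <= sin p.1
    & E (spherical_point p.1 p.2)].
  move=> [/=]; rewrite !in_itv /= => p1 p2.
  by have [t1 t2 ? ?] := rectP _ _ p1 p2; split=> //; split; rewrite /= in_itv.
have muQ : mu Q = ((b - a) * (d - c))%:E by exact: rectangle_measure.
apply: (@lt_le_trans _ _ (\int[mu]_(p in Q) (cst m%:E) p)%E).
  by rewrite integral_cst // [X in (_ * X)%E]muQ -EFinM lte_fin !mulr_gt0 // subr_gt0.
apply: (@le_trans _ _ (\int[mu]_(p in Q)
    ((E (spherical_point p.1 p.2))%:R * sin p.1)%:E)%E).
  apply: ge0_le_integral => //.
  - by move=> p _; rewrite lee_fin ltW.
  - apply/measurable_EFinP; apply: measurable_funM.
      exact: measurable_indicator.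
    exact: measurable_sin_theta.
  - by move=> p /QP[_ ? ->]; rewrite mul1r lee_fin.
apply: ge0_subset_integral => //.
- exact: measurable_angles.
- by case/integrableP: (integrable_indicator mE).
- by move=> p /sin_angles_ge0 ?; rewrite lee_fin mulr_ge0.
- by move=> p /QP[].
Qed.

End SphereArea.

(** * Spherical coordinates *)

Section SphericalCoordinates.
Variable R : realType.
Local Open Scope classical_set_scope.

Lemma spherical_point_coord (theta phi : R) (n : 'rV[R]_3) :
  (n *m spherical_point theta phi) 0 0 =
  n 0 0 * (sin theta * cos phi) + n 0 1 * (sin theta * sin phi)
    + n 0 (inord 2) * cos theta.
Proof.
have -> : inord 2 = lift ord0 (lift ord0 ord0) :> 'I_3.
  by apply: val_inj; rewrite /= inordK.
have -> : 1 = lift ord0 ord0 :> 'I_3 by apply: val_inj.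
by rewrite mxE !big_ord_recl big_ord0 addr0 !mxE /= addrA.
Qed.

(** The curve theta = phi meets each plane through the origin in finitely many
    points: with x = cos theta, the equation of the plane with normal
    (a, b, c) reads b (1 - x^2) + c x = - a x sin theta, and its square is a
    polynomial equation in x that is trivial only for a = b = c = 0. *)
Lemma avoid_planes (s : seq 'rV[R]_3) : (forall n, n \in s -> n != 0) ->
  exists theta : R, 0 < theta < pi /\
    forall n, n \in s -> (n *m spherical_point theta theta) 0 0 != 0.
Proof.
move=> s_neq0.
pose q (n : 'rV[R]_3) : {poly R} :=
  ((n 0 1)%:P * (1 - 'X ^+ 2) + (n 0 (inord 2))%:P * 'X) ^+ 2
    - (n 0 0)%:P ^+ 2 * (1 - 'X ^+ 2) * 'X ^+ 2.
have qE n x : (q n).[x] = (n 0 1 * (1 - x ^+ 2) + n 0 (inord 2) * x) ^+ 2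
    - n 0 0 ^+ 2 * (1 - x ^+ 2) * x ^+ 2 by rewrite /q !hornerE.
have q_neq0 n : n != 0 -> q n != 0.
  apply: contraNN => /eqP q0.
  (* The values at 0, 1 and 2 already determine a, b and c. *)
  have := qE n 0; rewrite q0 horner0 => /esym E0.
  have := qE n 1; rewrite q0 horner0 => /esym E1.
  have := qE n 2; rewrite q0 horner0 => /esym E2.
  have n1 : n 0 1 = 0 by apply/eqP; rewrite -sqrf_eq0 -E0; apply/eqP; ring.
  have n2 : n 0 (inord 2) = 0.
    by apply/eqP; rewrite -sqrf_eq0 -E1; apply/eqP; ring.
  have n0 : n 0 0 = 0.
    apply/eqP; rewrite -sqrf_eq0; apply/eqP; move: E2; rewrite n1 n2.
    by move=> ?; lra.
  apply/eqP/rowP => -[[|[|[|//]]] lt]; rewrite mxE.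
  - by rewrite -[RHS]n0; congr (n _ _); apply: val_inj.
  - by rewrite -[RHS]n1; congr (n _ _); apply: val_inj.
  - by rewrite -[RHS]n2; congr (n _ _); apply: val_inj; rewrite /= inordK.
pose Q := \prod_(n <- s) q n.
have Q_neq0 : Q != 0.
  by rewrite prodf_seq_neq0; apply/allP => n /s_neq0 /q_neq0 ->.
(* Infinitely many candidates for cos theta, all inside ]0, 1[ *)
pose x (k : nat) : R := k.+2%:R^-1.
have x_inj : injective x by move=> k l /invr_inj /eqP; rewrite eqr_nat => /eqP[].
have [k xk] : exists k, ~~ root Q (x k).
  apply: contrapT => /forallNP all_roots.
  have : (size [seq x k | k <- iota 0 (size Q)] < size Q)%N.
    apply: max_poly_roots => //; last by rewrite map_inj_uniq ?iota_uniq.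
    by apply/allP => _ /mapP[k _ ->]; apply/negPn/negP; exact: all_roots.
  by rewrite size_map size_iota ltnn.
have x_gt0 : 0 < x k by rewrite invr_gt0 ltr0n.
have x_lt1 : x k < 1 by rewrite invf_lt1 ?ltr0n // ltr1n.
exists (acos (x k)); split.
  by rewrite acos_gt0 ?acos_ltpi //; apply/andP; split; lra.
move=> n ns; apply: contra xk => /eqP n0.
rewrite /Q /root horner_prod prodf_seq_eq0; apply/hasP; exists n => //=.
rewrite qE; move: n0; rewrite spherical_point_coord.
have cosx : cos (acos (x k)) = x k.
  by rewrite acosK // in_itv /=; apply/andP; split; lra.
have := cos2Dsin2 (acos (x k)); rewrite cosx.
set y := x k; set z := sin _ => yz n0.
apply/eqP; rewrite (_ : 1 - y ^+ 2 = z ^+ 2); last by rewrite -yz addrC addKr.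
have -> : n 0 1 * z ^+ 2 + n 0 (inord 2) * y = - (n 0 0 * (z * y)).
  by apply/eqP; rewrite -addr_eq0 -[X in _ == X]n0; apply/eqP; ring.
by ring.
Qed.

Lemma spherical_point_unit (theta phi : R) :
  unit_sphere R (spherical_point theta phi).
Proof.
rewrite /unit_sphere /= !big_ord_recl big_ord0 addr0 !mxE /=.
transitivity (sin theta ^+ 2 * (cos phi ^+ 2 + sin phi ^+ 2) + cos theta ^+ 2).
  by ring.
by rewrite cos2Dsin2 mulr1 addrC cos2Dsin2.
Qed.

Lemma area_gt0_point (E : 'cV[R]_3 -> bool) :
  0 < area E -> exists2 x, unit_sphere R x & E x.
Proof.
move=> E_gt0; apply: contrapT => noE; move: E_gt0.
rewrite /area /sphere_integral integral0_eq ?ltxx // => a _.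
case: (boolP (E _)) => [Ea|_]; last by rewrite mul0r.
by case: noE; exists (spherical_point a.1 a.2) => //;
  exact: spherical_point_unit.
Qed.

Lemma measurable_coord (n : 'rV[R]_3) :
  measurable_fun setT
    (fun a : R * R => (n *m spherical_point a.1 a.2) 0 0).
Proof.
under eq_fun do rewrite spherical_point_coord.
have ms1 : measurable_fun setT (fun a : R * R => sin a.1).
  exact: measurable_sin_theta.
have mc1 : measurable_fun setT (fun a : R * R => cos a.1).
  apply: measurableT_comp; last exact: measurable_fst.
  by apply: continuous_measurable_fun; exact: continuous_cos.
have ms2 : measurable_fun setT (fun a : R * R => sin a.2).
  apply: measurableT_comp; last exact: measurable_snd.
  by apply: continuous_measurable_fun; exact: continuous_sin.
have mc2 : measurable_fun setT (fun a : R * R => cos a.2).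
  apply: measurableT_comp; last exact: measurable_snd.
  by apply: continuous_measurable_fun; exact: continuous_cos.
by repeat (apply: measurable_funD || apply: measurable_funM).
Qed.

Lemma measurable_forall d (T : measurableType d) (I : finType)
    (f : I -> T -> bool) :
  (forall i, measurable_fun setT (f i)) ->
  measurable_fun setT (fun a => [forall i, f i a]).
Proof.
move=> mf; apply: (measurable_fun_bool true); rewrite setTI.
rewrite (_ : _ @^-1` _ = \bigcap_(i in [set: I]) (f i @^-1` [set true])).
  apply: fin_bigcap_measurable => // i _.
  by rewrite -[X in measurable X]setTI; exact: mf.
apply/seteqP; split=> a /=; first by move=> /forallP fa i _ /=; exact: fa.
by move=> fa; apply/forallP => i; exact: fa.
Qed.

Lemma continuous_coord (n : 'rV[R]_3) :
  continuous (fun a : R * R => (n *m spherical_point a.1 a.2) 0 0).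
Proof.
move=> a; under eq_fun do rewrite spherical_point_coord.
have c1 : {for a, continuous (fst : R * R -> R)} by exact: cvg_fst.
have c2 : {for a, continuous (snd : R * R -> R)} by exact: cvg_snd.
have cs1 : {for a, continuous (fun a : R * R => sin a.1)}.
  exact: (continuous_comp c1 (@continuous_sin R _)).
have cc1 : {for a, continuous (fun a : R * R => cos a.1)}.
  exact: (continuous_comp c1 (@continuous_cos R _)).
have cs2 : {for a, continuous (fun a : R * R => sin a.2)}.
  exact: (continuous_comp c2 (@continuous_sin R _)).
have cc2 : {for a, continuous (fun a : R * R => cos a.2)}.
  exact: (continuous_comp c2 (@continuous_cos R _)).
apply: cvgD; first apply: cvgD.
- by apply: cvgM; [exact: cvg_cst|exact: cvgM].
- by apply: cvgM; [exact: cvg_cst|exact: cvgM].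
- by apply: cvgM; [exact: cvg_cst|].
Qed.

End SphericalCoordinates.

(** * Pieces of a fundamental domain *)

Section FundamentalDomain.
Variables (R : realType) (gT : finGroupType) (G : {group gT}).
Variable rot : mx_representation R G 3.
Hypothesis hrot : rotation_group rot.

(** The points fixed by a rotation g <> 1 lie in the plane orthogonal to a nonzero
    row of g - 1, so it suffices to avoid finitely many planes. *)
Lemma free_point : exists theta : R, 0 < theta < pi /\
  forall h, h \in G -> h != 1%g ->
    rot h *m spherical_point theta theta != spherical_point theta theta.
Proof.
pose s := [seq n <- [seq row i (rot h - 1%:M) | h <- enum G, i <- enum 'I_3]
             | n != 0].
have [n|theta [theta_itv thetaP]] := @avoid_planes R s.
  by rewrite mem_filter => /andP[].
exists theta; split=> // h Gh h_neq1.
have [i row_neq0] : exists i, row i (rot h - 1%:M) != 0.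
  apply/existsP; apply: contraR h_neq1; rewrite negb_exists => /forallP all0.
  have rot1 : rot h = 1%:M.
    apply/eqP; rewrite -subr_eq0; apply/eqP/row_matrixP => i.
    by rewrite (eqP (negbNE (all0 i))) row0.
  have /set1P -> : h \in [set 1%g] by apply: (fintype.subsetP hrot.1); apply/rkerP.
  exact: eqxx.
apply: contraNN (thetaP (row i (rot h - 1%:M)) _) => [/eqP fixed|].
  by rewrite -row_mul mulmxBl fixed mul1mx subrr !mxE.
rewrite mem_filter row_neq0; apply/allpairsP; exists (h, i).
by rewrite !mem_enum.
Qed.

Definition dot (u v : 'cV[R]_3) : R := (u^T *m v) 0 0.

(** |Au - u|^2 = 2 (u.u - u.Au) for an orthogonal matrix A. *)
Lemma dot_rotation_lt (A : 'M[R]_3) (u : 'cV[R]_3) :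
  is_rotation A -> A *m u != u -> dot u (A *m u) < dot u u.
Proof.
move=> [AAT _] Au.
have ATA : A^T *m A = 1%:M by exact: mulmx1C.
have : 0 < dot (A *m u - u) (A *m u - u).
  rewrite lt_neqAle eq_sym /dot mxE; apply/andP; split; last first.
    by apply: sumr_ge0 => i _; rewrite mxE -expr2 sqr_ge0.
  apply: contra Au; rewrite psumr_eq0 => [/allP all0|i _]; last first.
    by rewrite mxE -expr2 sqr_ge0.
  rewrite -subr_eq0; apply/eqP/colP => i; rewrite [RHS]mxE.
  by have := all0 i; rewrite mem_index_enum mxE mulf_eq0 orbb => /(_ isT)/eqP.
have subE (X Y Z W : 'M[R]_1) : (X - Y - (Z - W)) 0 0 =
  X 0 0 - Y 0 0 - (Z 0 0 - W 0 0) by rewrite !mxE.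
rewrite /dot [(_ - _)^T]linearB /= trmx_mul mulmxBl !mulmxBr -!mulmxA (mulmxA A^T) ATA.
rewrite mul1mx subE.
have -> : (u^T *m (A^T *m u)) 0 0 = (u^T *m (A *m u)) 0 0.
  transitivity ((u^T *m (A *m u))^T 0 0); last by rewrite mxE.
  by rewrite !trmx_mul trmxK mulmxA.
by move=> ?; lra.
Qed.

(** The open cell of u in the Voronoi partition of the sphere by the orbit of
    u: as |hu| = |u|, the condition says that h^-1 u is farther from y than u. *)
Definition dirichlet_cell (u y : 'cV[R]_3) : bool :=
  [forall h in G, (h != 1%g) ==> (dot u (rot h *m y) < dot u y)].

Lemma dirichlet_cell_disjoint (u x : 'cV[R]_3) (g h : gT) :
  g \in G -> h \in G ->
  dirichlet_cell u (rot (g^-1)%g *m x) -> dirichlet_cell u (rot (h^-1)%g *m x) ->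
  g = h.
Proof.
move=> Gg Gh /forall_inP Cg /forall_inP Ch; apply/eqP/negPn/negP => gh.
(* Each of g^-1 x and h^-1 x would have the larger scalar product with u. *)
have := Cg (h^-1 * g)%g; rewrite groupM ?groupV // => /(_ isT)/implyP.
have := Ch (g^-1 * h)%g; rewrite groupM ?groupV // => /(_ isT)/implyP.
rewrite -!eq_mulVg1 (negbTE gh) eq_sym (negbTE gh) => /(_ isT) lt1.
move=> /(_ isT); apply/negP; rewrite -leNgt ltW //; move: lt1.
by rewrite !mulmxA -!repr_mxM ?groupM ?groupV // !mulgK.
Qed.

Lemma measurable_dirichlet_cell (u : 'cV[R]_3) (A : 'M[R]_3) :
  sphere_measurable (fun x => dirichlet_cell u (A *m x)).
Proof.
apply: measurable_forall => h.
case: (h \in G) => //=; case: (h != 1%g) => //=.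
rewrite /dot; under eq_fun do rewrite !mulmxA.
by apply: measurable_fun_ltr; exact: measurable_coord.
Qed.

Lemma dirichlet_cell_near (theta phi : R) :
  let u := spherical_point theta phi in
  (forall h, h \in G -> h != 1%g -> rot h *m u != u) ->
  \forall a \near (theta, phi), dirichlet_cell u (spherical_point a.1 a.2).
Proof.
move=> u free.
have near_h h : \forall a \near (theta, phi), (h \in G) ==>
    ((h != 1%g) ==> (dot u (rot h *m spherical_point a.1 a.2)
                       < dot u (spherical_point a.1 a.2))).
  case: (boolP (h \in G)) => [Gh|_]; last exact: (@filterE _ (nbhs (theta, phi))).
  case: (boolP (h != 1%g)) => [h1|_]; last exact: (@filterE _ (nbhs (theta, phi))).
  suff: \forall a \near (theta, phi),
      0 < dot u (spherical_point a.1 a.2)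
        - (u^T *m rot h *m spherical_point a.1 a.2) 0 0.
    by apply: filterS => a; rewrite subr_gt0 /dot mulmxA.
  have /(_ (theta, phi)) cont : continuous (fun a : R * R =>
      dot u (spherical_point a.1 a.2)
        - (u^T *m rot h *m spherical_point a.1 a.2) 0 0).
    by move=> a; apply: cvgB; exact: continuous_coord.
  have pos : 0 < dot u u - (u^T *m rot h *m u) 0 0.
    by rewrite subr_gt0 -mulmxA dot_rotation_lt ?free //; exact: hrot.2.
  exact: (cont _ (lt_nbhsr pos)).
by apply: filterS (filter_forall _ near_h) => a all_h; apply/forallP.
Qed.

(** The pieces are the parts of a Dirichlet cell that lie in the strips
    theta_i <= theta < theta_(i+1) between circles of latitude, for a sequence
    theta_i that increases from the polar angle of u in small steps, so that
    each strip meets a neighbourhood of u. *)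
Lemma fundamental_pieces (I : finType) :
  exists E : I -> 'cV[R]_3 -> bool,
    [/\ forall g h i j x, g \in G -> h \in G ->
          E i (rot (g^-1)%g *m x) -> E j (rot (h^-1)%g *m x) -> g = h /\ i = j,
        forall i (A : 'M[R]_3), sphere_measurable (fun x => E i (A *m x))
      & forall i, 0 < area (E i)].
Proof.
have [theta [/andP[theta_gt0 theta_ltpi] free]] := free_point.
pose u := spherical_point theta theta.
have sin_gt0 : 0 < sin theta by rewrite sin_gt0_pi // theta_gt0.
(* A lower bound for the density of the area near u *)
pose m := sin theta / 2.
have cell_near : \forall a \near (theta, theta),
    dirichlet_cell u (spherical_point a.1 a.2) /\ m < sin a.1.
  apply: filterI; first exact: dirichlet_cell_near.
  have /(_ (theta, theta)) cont : continuous (fun a : R * R => sin a.1).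
    move=> a; apply: (continuous_comp _ (@continuous_sin R _)).
    exact: cvg_fst.
  have m_lt : m < sin theta by rewrite /m; lra.
  exact: (cont _ (lt_nbhsr m_lt)).
move: cell_near => /nbhs_ballP[e /= e_gt0 ballP].
(* Small enough for [theta, theta + r]^2 to lie in the ball and in ]0, pi[^2 *)
pose r := Num.min e (Num.min theta (pi - theta)) / 2.
have r_gt0 : 0 < r.
  by rewrite divr_gt0 // !lt_min e_gt0 theta_gt0 subr_gt0.
have [re rtheta rpi] : [/\ r < e, r < theta & r < pi - theta].
  have min_gt0 : 0 < Num.min e (Num.min theta (pi - theta)).
    by rewrite !lt_min e_gt0 theta_gt0 subr_gt0.
  have : r < Num.min e (Num.min theta (pi - theta)) by rewrite /r; lra.
  by rewrite !lt_min => /and3P[].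
pose t k := theta + r * k%:R / #|I|%:R.
pose E (i : I) y := dirichlet_cell u y && ((cos (t (enum_rank i).+1) < y (inord 2) 0)
  && (y (inord 2) 0 <= cos (t (enum_rank i)))).
have t_incr k l : (k < l <= #|I|)%N -> t k < t l.
  move=> /andP[kl lI]; have I_gt0 : (0 < #|I|)%N.
    exact: leq_trans (leq_ltn_trans (leq0n k) kl) lI.
  by rewrite ltrD2l ltr_pM2r ?invr_gt0 ?ltr0n // ltr_pM2l // ltr_nat.
have t_itv k : (k <= #|I|)%N -> theta <= t k <= theta + r.
  case: k => [_|k kI]; first by rewrite /t mulr0 mul0r addr0 lexx lerDl ltW.
  have I_gt0 : (0 < #|I|)%N by exact: leq_trans kI.
  rewrite lerDl lerD2l; apply/andP; split.
    by rewrite divr_ge0 // mulr_ge0 // ltW.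
  by rewrite -mulrA ger_pMr // ler_pdivrMr ?ltr0n // mul1r ler_nat.
have cosE x y : theta <= x <= theta + r -> theta <= y <= theta + r ->
    (cos x < cos y) = (y < x).
  by move=> ? ?; rewrite ltr_cos // in_itv /=; apply/andP; split; lra.
have coord_row : forall (A : 'M[R]_3) (y : 'cV[R]_3) c, (A *m y) c 0 = (row c A *m y) 0 0.
  by move=> A y c; rewrite -row_mul [RHS]mxE.
have mE i A : sphere_measurable (fun x => E i (A *m x)).
  apply: measurable_and; last first.
    apply: measurable_and.
      apply: measurable_fun_ltr => //.
      under eq_fun do rewrite coord_row; exact: measurable_coord.
    apply: measurable_fun_ler => //.
    under eq_fun do rewrite coord_row; exact: measurable_coord.
  exact: measurable_dirichlet_cell.
exists E; split=> //.
- move=> g h i j x Gg Gh /andP[Cg /andP[ig gi]] /andP[Ch /andP[jh hj]].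
  have gh := dirichlet_cell_disjoint Gg Gh Cg Ch.
  split=> //; move: ig gi jh hj; rewrite gh.
  set z := (_ *m _) _ _ => ig gi jh hj.
  have rank_le (k : I) : (enum_rank k <= #|I|)%N by apply: ltnW; exact: ltn_ord.
  have key (k l : I) : cos (t (enum_rank k).+1) < z -> z <= cos (t (enum_rank l)) ->
      ~~ (enum_rank k < enum_rank l)%N.
    move=> kz zl; apply/negP => kl.
    have := lt_le_trans kz zl; rewrite cosE ?t_itv ?ltn_ord ?rank_le //.
    rewrite ltNge; move: kl; rewrite leq_eqVlt => /predU1P[->|kl].
      by rewrite lexx.
    by rewrite ltW // t_incr // kl rank_le.
  have ij := key _ _ ig hj.
  have ji := key _ _ jh gi.
  apply: enum_rank_inj; apply: ord_inj; apply/eqP.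
  by rewrite eqn_leq leqNgt ji leqNgt ij.
- move=> i.
  have ti : t (enum_rank i) < t (enum_rank i).+1 by rewrite t_incr ?ltnSn ?ltn_ord.
  have := t_itv (enum_rank i) (ltnW (ltn_ord _)).
  have := t_itv (enum_rank i).+1 (ltn_ord _).
  set t0 := t (enum_rank i) in ti *; set t1 := t _ in ti * => t1_itv t0_itv.
  have mEi : sphere_measurable (E i).
    by have := mE i 1%:M; rewrite /sphere_measurable; under eq_fun do rewrite mul1mx.
  (* Only half of the strip, as cos t1 < y_2 excludes its end t1 *)
  apply: (@area_gt0 _ _ t0 ((t0 + t1) / 2) theta (theta + r) m) => //.
  + by lra.
  + by lra.
  + by rewrite /m; lra.
  move=> x y x_itv y_itv; have [|cell_xy m_lt] := ballP (x, y).
    by split; rewrite /= /ball /= ltr_norml; apply/andP; split; lra.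
  split; [by lra|by lra|exact: ltW|].
  rewrite /E cell_xy /= mxE inordK //= -/t0 -/t1; apply/andP; split.
    by rewrite cosE; lra.
  by rewrite leNgt cosE -?leNgt; lra.
Qed.

End FundamentalDomain.

(** * Simple functions on disjoint pieces *)

Section DisjointIndicators.
Variables (R : pzRingType) (P : finType) (B : P -> bool).
Hypothesis disj : forall p q, B p -> B q -> p = q.

Lemma sum_disjoint (c : P -> R) (p : P) :
  B p -> \sum_q c q * (B q)%:R = c p.
Proof.
move=> Bp; rewrite (bigD1 p) //= Bp mulr1 big1 ?addr0 // => q qp.
case: (boolP (B q)) => [Bq|_]; last by rewrite mulr0.
by rewrite (disj Bq Bp) eqxx in qp.
Qed.

Lemma mul_sum_disjoint (c1 c2 : P -> R) :
  (\sum_p c1 p * (B p)%:R) * (\sum_p c2 p * (B p)%:R)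
    = \sum_p c1 p * c2 p * (B p)%:R.
Proof.
case: (pickP B) => [p Bp|B0]; first by rewrite !(sum_disjoint _ Bp).
have sum0 c : \sum_p c p * (B p)%:R = 0 :> R.
  by rewrite big1 // => p _; rewrite B0 mulr0.
by rewrite !sum0 mulr0.
Qed.

End DisjointIndicators.

(** * Real irreps and real basis functions *)

Section RealBasis.
Variables (R : realType) (gT : finGroupType) (G : {group gT}).
Variable d : nat.

Lemma real_matrices (Gamma : mx_representation R[i] G d) :
  (forall g, g \in G -> Gamma g \is unitarymx) ->
  (forall g, g \in G -> Gamma g \is a realmx) ->
  exists A : gT -> 'M[R]_d,
    [/\ forall g, g \in G -> Gamma g = map_mx (real_complex R) (A g),
        forall g h, g \in G -> h \in G -> A (g * h)%g = A g *m A h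
      & forall g, g \in G ->
          A g *m (A g)^T = 1%:M /\ A (g^-1)%g = (A g)^T].
Proof.
move=> unit real; pose A g := map_mx (@complex.Re R) (Gamma g).
have GammaE g : g \in G -> Gamma g = map_mx (real_complex R) (A g).
  move=> /real /mxOverP Gr; apply/matrixP => j k; rewrite !mxE.
  by rewrite -[LHS]RRe_real.
have inj : injective (map_mx (real_complex R) : 'M[R]_d -> 'M[R[i]]_d).
  exact: map_mx_inj.
have AM g h : g \in G -> h \in G -> A (g * h)%g = A g *m A h.
  by move=> Gg Gh; apply: inj; rewrite map_mxM -!GammaE ?groupM ?repr_mxM.
exists A; split=> // g Gg.
have AAT : A g *m (A g)^T = 1%:M.
  apply: inj; rewrite map_mxM map_mx1 -map_trmx -GammaE //.
  by have /unitarymxP := unit g Gg; rewrite -map_trmx realmxC ?real.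
split=> //.
have A1 : A g *m A (g^-1)%g = 1%:M.
  by rewrite -AM ?groupV // mulgV; apply: inj; rewrite -GammaE // repr_mx1 map_mx1.
by rewrite -[LHS]mul1mx -(mulmx1C AAT) -mulmxA A1 mulmx1.
Qed.

Variable rot : mx_representation R G 3.
Hypothesis hrot : rotation_group rot.

(** The function F(x) = sum_g A(g) H(g^-1 x), where the coordinates of H on the
    pieces are square roots of the coefficients given by [tverberg_cone] for the
    areas of the translated pieces. *)
Lemma equivariant_functions (A : gT -> 'M[R]_d) :
  (forall g h, g \in G -> h \in G -> A (g * h)%g = A g *m A h) ->
  (forall g, g \in G -> A g *m (A g)^T = 1%:M /\ A (g^-1)%g = (A g)^T) ->
  exists F : 'I_d -> 'cV[R]_3 -> R,
    [/\ sphere_orthonormal F,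
        forall k, exists x, [/\ unit_sphere R x, F k x != 0
          & forall j, j != k -> F j x = 0]
      & forall g j x, g \in G ->
          F j (rot (g^-1)%g *m x) = \sum_m A g m j * F m x].
Proof.
move=> AM Aorth.
have [I tverberg] := tverberg_cone R gT d.
have [E [Edisj mE E_gt0]] := fundamental_pieces hrot I.
(* Indexed by all of gT, so that the weights of a piece form a vector over gT
   whose entries outside G are 0 *)
pose B (p : gT * I) x := (p.1 \in G) && E p.2 (rot (p.1^-1)%g *m x).
have mB p : sphere_measurable (B p).
  by apply: measurable_and => //; exact: mE.
have Bdisj x p q : B p x -> B q x -> p = q.
  case: p q => [g i] [h j] /= /andP[/= Gg Ex] /andP[/= Gh Ey].
  by have [-> ->] := Edisj _ _ _ _ _ Gg Gh Ex Ey.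
have B1 i x : E i x -> B (1%g, i) x.
  by rewrite /B /= group1 invg1 repr_mx1 mul1mx.
have [|a [c [a_ge0 a_disj a_sum c_gt0]]] := tverberg (fun i g => area (B (g, i))).
  move=> i; rewrite (bigD1 1%g) //= ltr_wpDr //.
    by apply: sumr_ge0 => g _; exact: area_ge0.
  rewrite (_ : B _ = E i) ?E_gt0 //; apply/funext => x.
  by rewrite /B /= group1 invg1 repr_mx1 mul1mx.
have lt_label (l : 'I_d) : (l < 2 ^ d)%N.
  exact: ltn_trans (ltn_ord l) (ltn_expl _ _).
(* The squared norm of every F j when the coefficients are sqrt (a l i) *)
pose C := \sum_g c g.
pose h (l : 'I_d) i := Num.sqrt (a l i / C).
have h_disj (l m : 'I_d) i : h l i * h m i = (l == m)%:R * (a l i / C).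
  rewrite -sqrtrM; last by rewrite divr_ge0 // ltW.
  have [->|lm] := eqVneq l m.
    by rewrite mul1r -expr2 sqrtr_sqr ger0_norm // divr_ge0 // ltW.
  by rewrite mulrACA a_disj // !mul0r sqrtr0.
pose coef j (p : gT * I) := \sum_l A p.1 j l * h l p.2.
pose F j x := \sum_p coef j p * (B p x)%:R.
have orth j k : sphere_integral (fun x => F j x * F k x) = (j == k)%:R%:E.
  have -> : (fun x => F j x * F k x) =
      fun x => \sum_p coef j p * coef k p * (B p x)%:R.
    by apply/funext => x; rewrite /F (mul_sum_disjoint (B := B^~ x)) //;
      exact: Bdisj.
  rewrite sphere_integral_simple //; congr EFin.
  (* The disjoint supports of the h l leave the diagonal terms. *)
  have term g i : coef j (g, i) * coef k (g, i) * area (B (g, i)) =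
      \sum_l A g j l * A g k l / C * (a l i * area (B (g, i))).
    rewrite big_distrlr /= mulr_suml; apply: eq_bigr => l _.
    rewrite (bigD1 l) //= big1 ?addr0 => [|m ml].
      by rewrite mulrACA h_disj eqxx mul1r; ring.
    by rewrite mulrACA h_disj eq_sym (negbTE ml) mul0r mulr0.
  have term_g g : \sum_i coef j (g, i) * coef k (g, i) * area (B (g, i)) =
      (j == k)%:R / C * c g.
    under eq_bigr do rewrite term.
    rewrite exchange_big /=.
    transitivity ((A g *m (A g)^T) j k / C * c g).
      rewrite mxE !mulr_suml; apply: eq_bigr => l _.
      by rewrite -mulr_sumr a_sum // mxE.
    case: (boolP (g \in G)) => [Gg|nGg]; first by rewrite (Aorth g Gg).1 mxE.
    suff -> : c g = 0 by rewrite !mulr0.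
    rewrite -(a_sum 0%N) ?expn_gt0 // big1 // => i _.
    rewrite (_ : B _ = fun=> false) ?area_false ?mulr0 //.
    by apply/funext => x; rewrite /B /= (negbTE nGg).
  transitivity (\sum_g \sum_i coef j (g, i) * coef k (g, i) * area (B (g, i))).
    by rewrite pair_bigA; apply: eq_bigr => -[].
  under eq_bigr do rewrite term_g.
  by rewrite -mulr_sumr -/C mulfVK // gt_eqF.
have A1 : A 1%g = 1%:M.
  have [AAT AT] := Aorth 1%g (group1 G).
  by rewrite -[LHS]mulmx1 -AAT -AT invg1 -!AM ?mulg1 // -[RHS]AAT -AT invg1 -AM // mulg1.
have F_orth : sphere_orthonormal F.
  split=> // j; split.
    apply: measurable_sum => p; apply: measurable_funM; first exact: measurable_cst.
    exact: measurable_indicator.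
  under [X in sphere_integral X]eq_fun do rewrite expr2.
  by rewrite orth ltry.
exists F; split=> //.
- move=> k.
  have [i a_neq0] : exists i, a k i != 0.
    apply/existsP; apply: contraTT c_gt0; rewrite negb_exists => /forallP a0.
    rewrite -leNgt big1 // => g _; rewrite -(a_sum k) ?lt_label // big1 // => i _.
    by rewrite (eqP (negbNE (a0 i))) mul0r.
  have [x x_unit Ex] := area_gt0_point (E_gt0 i).
  have FE j : F j x = h j i.
    rewrite /F (sum_disjoint (@Bdisj x) _ (B1 _ _ Ex)) /coef /= A1.
    rewrite (bigD1 j) //= big1 ?addr0 => [|l lj]; first by rewrite mxE eqxx mul1r.
    by rewrite mxE eq_sym (negbTE lj) mul0r.
  have h_neq0 : h k i != 0.
    by rewrite sqrtr_eq0 -ltNge divr_gt0 // lt_neqAle eq_sym a_neq0 a_ge0.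
  exists x; split=> //; first by rewrite FE.
  move=> j jk; rewrite FE; apply/eqP.
  have /eqP := h_disj j k i.
  by rewrite (negbTE jk) mul0r mulf_eq0 (negbTE h_neq0) orbF.
- move=> g j x Gg.
  have FE k y : F k y = \sum_g \sum_i coef k (g, i) * (B (g, i) y)%:R.
    by rewrite pair_bigA; apply: eq_bigr => -[].
  under eq_bigr do rewrite FE mulr_sumr.
  (* F j (g^-1 x) = sum_f A(g^-1 f) H(f^-1 x), and A(g^-1) = A(g)^T *)
  rewrite FE [RHS]exchange_big /= [LHS](reindex_inj (mulgI (g^-1)%g)) /=.
  apply: eq_bigr => f _.
  under [RHS]eq_bigr do rewrite mulr_sumr.
  rewrite exchange_big /=; apply: eq_bigr => i _.
  rewrite /B /= groupMl ?groupV //; case: (boolP (f \in G)) => [Gf|_]; last first.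
    by rewrite mulr0 big1 // => m _; rewrite !mulr0.
  rewrite invMg invgK mulmxA -repr_mxM ?groupM ?groupV // mulgK /=.
  under [RHS]eq_bigr do rewrite mulrA.
  rewrite -mulr_suml; congr (_ * _).
  rewrite /coef /= AM ?groupV // (Aorth g Gg).2.
  under [RHS]eq_bigr do rewrite mulr_sumr.
  rewrite exchange_big /=; apply: eq_bigr => l _.
  rewrite mxE mulr_suml; apply: eq_bigr => m _.
  by rewrite mxE mulrA.
Qed.

Lemma lin_indep_of_separated (F : 'I_d -> 'cV[R]_3 -> R) :
  (forall k, exists x, [/\ unit_sphere R x, F k x != 0
          & forall j, j != k -> F j x = 0]) ->
  sphere_lin_indep (fun j x => (F j x)%:C).
Proof.
move=> sepF c c0 k; have [x [x_unit Fk Fj]] := sepF k.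
have /eqP := c0 x x_unit; rewrite (bigD1 k) //= big1 => [|j jk]; last first.
  by rewrite Fj // rmorph0 mulr0.
by rewrite addr0 mulf_eq0 fmorph_eq0 (negbTE Fk) orbF => /eqP.
Qed.

Lemma realmx_of_real_basis (Gamma : mx_representation R[i] G d)
    (F : 'I_d -> 'cV[R]_3 -> R) :
  is_basis_of_irrep rot Gamma (fun j x => (F j x)%:C) ->
  forall g, g \in G -> Gamma g \is a realmx.
Proof.
move=> [indep equiv] g Gg; apply/mxOverP => m j.
apply/Creal_ImP; move: m.
apply: (indep (fun m => 'Im (Gamma g m j))) => x x_unit.
have -> : \sum_m 'Im (Gamma g m j) * (F m x)%:C
    = 'Im (\sum_m Gamma g m j * (F m x)%:C).
  rewrite raddf_sum; apply: eq_bigr => m _ /=.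
  by rewrite ImMr // complex_real.
by rewrite -equiv // /rotation_op; apply/Creal_ImP; rewrite complex_real.
Qed.

End RealBasis.

Theorem lemma4p2 (R : realType) (gT : finGroupType) (G : {group gT})
    (rot : mx_representation R G 3) (hrot : rotation_group rot)
    (d : nat) (rho : mx_representation R[i] G d) (hrho : mx_irreducible rho) :
  (exists (Gamma : mx_representation R[i] G d) (F : 'I_d -> 'cV[R]_3 -> R),
      [/\ unitary_realization rho Gamma,
          sphere_orthonormal F
        & is_basis_of_irrep rot Gamma (fun j x => (F j x)%:C)])
  <->
  (exists Gamma : mx_representation R[i] G d,
      unitary_realization rho Gamma /\
      forall g, g \in G -> Gamma g \is a realmx).
Proof.
split=> [[Gamma [F [Gamma_rho _ F_basis]]]|[Gamma [Gamma_rho Gamma_real]]].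
  by exists Gamma; split=> //; exact: realmx_of_real_basis F_basis.
have [A [GammaE AM Aorth]] := real_matrices Gamma_rho.2 Gamma_real.
have [F [F_orth F_sep F_equiv]] := equivariant_functions hrot AM Aorth.
exists Gamma, F; split=> //; split; first exact: lin_indep_of_separated.
move=> g Gg j x _; rewrite /rotation_op -repr_mxV // F_equiv // rmorph_sum.
by apply: eq_bigr => m _; rewrite rmorphM GammaE // mxE.
Qed.
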